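(* Let $p\in\mathbb{N}$, $d_{\mathrm{refl}}(p):=\lfloor (p+2)/3\rfloor$, and let $K$ be a tetrahedron with vertices $A_0,A_1,A_2,A_3$. (a) The functions $Q^{(i)}_k$ on $\partial K$, $0\le k\le d_{\mathrm{refl}}(p)-1$, $i=0,1,2,3$, are linearly independent. (b) For every facet $T$ of $K$, $\operatorname{span}\{b^{\mathrm{refl}}_{p,m}\circ\chi_{\mathbf{V},T}^{-1}:\ \mathbf{V}\text{ a vertex of }T,\ 0\le m\le d_{\mathrm{refl}}(p)-1\}=\mathbb{P}^{\perp,\mathrm{refl}}_{p,p-1}(T)$.
   Context: $\widehat T$ is the triangle with vertices $(0,0),(1,0),(0,1)$. With Jacobi polynomials $P_m^{(\alpha,\beta)}$ ($P_m^{(\alpha,\beta)}(1)=(\alpha+1)_m/m!$) and Legendre polynomials $P^{(0,0)}_k$, $b_{p,k}(x_1,x_2):=(x_1+x_2)^kP^{(0,2k+1)}_{p-k}(2(x_1+x_2)-1)P^{(0,0)}_k\!\left(\frac{x_1-x_2}{x_1+x_2}\right)$. Let $Mq(x_1,x_2):=q(1-x_1-x_2,x_2)$, $Rq(x_1,x_2):=q(x_2,x_1)$, $\Pi:=\frac13(2I-MR-RM)$, and $b^{\mathrm{refl}}_{p,k}:=\Pi b_{p,2k}=\frac13\big(2b_{p,2k}(x_1,x_2)-b_{p,2k}(x_2,1-x_1-x_2)-b_{p,2k}(1-x_1-x_2,x_1)\big)$; it satisfies $b^{\mathrm{refl}}_{p,k}(x_1,x_2)=b^{\mathrm{refl}}_{p,k}(x_2,x_1)$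 and $t\mapsto b^{\mathrm{refl}}_{p,k}(t,1-t)$ is invariant under $t\mapsto 1-t$. $Q^{(0)}_k$ is the piecewise polynomial on $\partial K$ defined as follows: on each facet $A_0A_iA_j$ containing $A_0$ it equals $b^{\mathrm{refl}}_{p,k}$ in local coordinates mapping $A_0,A_i,A_j$ to $(0,0),(1,0),(0,1)$ (independent of the ordering of $A_i,A_j$); on the facet $A_1A_2A_3$ it is a totally symmetric polynomial of degree $p$ (invariant under all affine self-maps of that triangle) whose values on each edge agree with $t\mapsto b^{\mathrm{refl}}_{p,k}(t,1-t)$. $Q^{(i)}_k$, $i=1,2,3$, are defined analogously with $A_i$ in the role of $A_0$. For a triangle $T$ and vertex $\mathbf{V}$ of $T$, $\chi_{\mathbf{V},T}:\widehat T\to T$ is an affine bijection with $\chi_{\mathbf{V},T}(0)=\mathbf{V}$. $\mathbb{P}^{\perp,\mathrm{refl}}_{p,p-1}(\widehat T):=\operatorname{span}\{RM\Pi b_{p,2k},MR\Pi b_{p,2k}:0\le k\le\frac{p-1}{3}\}$ and $\mathbb{P}^{\perp,\mathrm{refl}}_{p,p-1}(T):=\{u\circ\chi_{\mathbf{P},T}^{-1}:u\in\mathbb{P}^{\perp,\mathrm{refl}}_{p,p-1}(\widehat T)\}$ for a vertex $\mathbf{P}$ of $T$ (independent of the choice of $\mathbf{P}$). *)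

(* Defs.v *)
From HB Require Import structures.
From mathcomp Require Import all_boot all_order all_algebra.
From mathcomp Require Import reals.
From Stdlib Require Import ClassicalEpsilon.
From mathcomp.algebra_tactics Require Import ring.
Set Implicit Arguments.
Unset Strict Implicit.
Unset Printing Implicit Defensive.
Import Order.TTheory GRing.Theory Num.Theory.
Local Open Scope ring_scope.

Section Defs.
Variable R : realType.

(* Jacobi polynomial P_n^{(a,b)}(x), explicit formula
   sum_s C(n+a,n-s) C(n+b,s) ((x-1)/2)^s ((x+1)/2)^(n-s);
   P_n^{(a,b)}(1) = C(n+a,n) = (a+1)_n/n!. *)
Definition jacobi (a b n : nat) (x : R) : R :=
  \sum_(s < n.+1) ('C(n + a, n - s) * 'C(n + b, s))%:R
     * ((x - 1) / 2) ^+ s * ((x + 1) / 2) ^+ (n - s).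

(* Homogenized Jacobi polynomial: hjacobi a b n x y = y^n P_n^{(a,b)}(x/y)
   for y <> 0 (lemma hjacobiE below); it is the polynomial extension. *)
Definition hjacobi (a b n : nat) (x y : R) : R :=
  \sum_(s < n.+1) ('C(n + a, n - s) * 'C(n + b, s))%:R
     * ((x - y) / 2) ^+ s * ((x + y) / 2) ^+ (n - s).

Lemma hjacobiE a b n x y : y != 0 ->
  hjacobi a b n x y = y ^+ n * jacobi a b n (x / y).
Proof.
move=> y0; rewrite /hjacobi /jacobi mulr_sumr; apply: eq_bigr => -[s /= hs] _.
have e1 : (x - y) / 2 = y * ((x / y - 1) / 2).
  by field.
have e2 : (x + y) / 2 = y * ((x / y + 1) / 2).
  by field.
rewrite e1 e2 !exprMn.
have ey : y ^+ n = y ^+ s * y ^+ (n - s) by rewrite -exprD subnKC // -ltnS.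
rewrite ey; ring.
Qed.

(* b_{p,k}(x1,x2) = (x1+x2)^k P^{(0,2k+1)}_{p-k}(2(x1+x2)-1) P_k((x1-x2)/(x1+x2)) *)
Definition bpk (p k : nat) (x1 x2 : R) : R :=
  jacobi 0 (2 * k + 1) (p - k) (2 * (x1 + x2) - 1) * hjacobi 0 0 k (x1 - x2) (x1 + x2).

(* Pi q = 1/3 (2 q - MR q - RM q) *)
Definition Pi (q : R -> R -> R) (x1 x2 : R) : R :=
  (2 * q x1 x2 - q x2 (1 - x1 - x2) - q (1 - x1 - x2) x1) / 3.

Definition brefl (p k : nat) : R -> R -> R := Pi (bpk p (2 * k)).

Definition d_refl (p : nat) : nat := (p + 2) %/ 3.

Definition in_tri (s t : R) : Prop := 0 <= s /\ 0 <= t /\ s + t <= 1.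

Definition poly2_le (p : nat) (q : R -> R -> R) : Prop :=
  exists c : nat -> nat -> R, forall s t,
    q s t = \sum_(i < p.+1) \sum_(j < p.+1 | (i + j <= p)%N) c i j * s ^+ i * t ^+ j.

Notation point := 'rV[R]_3.

Definition chi (V W U : point) (s t : R) : point := V + s *: (W - V) + t *: (U - V).

(* its inverse on the triangle T = VWU (choice-based; exact on T when T is
   non-degenerate) *)
Definition chi_inv (V W U : point) (x : point) : R * R :=
  epsilon (inhabits (0, 0)) (fun st => in_tri st.1 st.2 /\ chi V W U st.1 st.2 = x).

Definition tetrahedron (A : 'I_4 -> point) : Prop :=
  \det (\matrix_(i < 3) (A (lift ord0 i) - A ord0)) != 0.

Definition on_tri (V W U : point) (x : point) : Prop :=
  exists s t, in_tri s t /\ x = chi V W U s t.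

Definition boundary (A : 'I_4 -> point) (x : point) : Prop :=
  exists i j l : 'I_4, [/\ i != j, j != l & i != l] /\ on_tri (A i) (A j) (A l) x.

Definition is_Q (p : nat) (A : 'I_4 -> point) (Q : 'I_4 -> nat -> point -> R) : Prop :=
  forall (i : 'I_4) (k : nat), (k < d_refl p)%N ->
    (forall j l : 'I_4, [/\ i != j, i != l & j != l] ->
       forall s t, in_tri s t -> Q i k (chi (A i) (A j) (A l) s t) = brefl p k s t)
    /\
    (exists q : R -> R -> R,
       poly2_le p q
       /\ (forall s t, let u := 1 - s - t in
             [/\ q s t = q t s, q s t = q u t, q s t = q t u,
                 q s t = q u s & q s t = q s u])
       /\ (forall t, 0 <= t <= 1 ->
             [/\ q t (1 - t) = brefl p k t (1 - t),
                 q t 0 = brefl p k t (1 - t)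
               & q 0 t = brefl p k t (1 - t)])
       /\ (forall j l m : 'I_4,
             [/\ i != j, i != l, i != m & [/\ j != l, j != m & l != m]] ->
             forall s t, in_tri s t -> Q i k (chi (A j) (A l) (A m) s t) = q s t)).

Definition span_on (P : point -> Prop) (gs : seq (point -> R)) (h : point -> R) : Prop :=
  exists c : nat -> R, forall x, P x ->
    h x = \sum_(n < size gs) c n * nth (fun _ => 0) gs n x.

(* P^{perp,refl}_{p,p-1}(hat T) = span{ RM Pi b_{p,2k}, MR Pi b_{p,2k} : 0 <= k <= (p-1)/3 } *)
Definition Pperp_ref (p : nat) (u : R -> R -> R) : Prop :=
  exists c1 c2 : nat -> R, forall s t,
    u s t = \sum_(k < p.+1 | (3 * k + 1 <= p)%N)
              (c1 k * brefl p k (1 - s - t) s + c2 k * brefl p k t (1 - s - t)).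

Definition PperpT (p : nat) (V W U : point) (h : point -> R) : Prop :=
  exists u, Pperp_ref p u /\
    forall x, on_tri V W U x -> h x = u (chi_inv V W U x).1 (chi_inv V W U x).2.

Definition brefl_pull (p m : nat) (V W U : point) : point -> R :=
  fun x => brefl p m (chi_inv V W U x).1 (chi_inv V W U x).2.

(* affine bijection hat T -> T with 0 |-> V: the two possible orientations *)
Definition orient (b : bool) (W U : point) : point * point := if b then (W, U) else (U, W).

(* generators { b^refl_{p,m} o chi_{V,T}^{-1} : V vertex of T, m < d_refl p },
   T = V0 V1 V2, with an arbitrary choice (bits b0 b1 b2) of chi_{V,T} *)
Definition refl_gens (p : nat) (V0 V1 V2 : point) (b0 b1 b2 : bool) : seq (point -> R) :=
  [seq brefl_pull p m V0 (orient b0 V1 V2).1 (orient b0 V1 V2).2 | m <- iota 0 (d_refl p)]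
  ++ [seq brefl_pull p m V1 (orient b1 V2 V0).1 (orient b1 V2 V0).2 | m <- iota 0 (d_refl p)]
  ++ [seq brefl_pull p m V2 (orient b2 V0 V1).1 (orient b2 V0 V1).2 | m <- iota 0 (d_refl p)].

End Defs.

(* Main.v *)
Require Import Defs.
From HB Require Import structures.
From mathcomp Require Import all_boot all_order all_algebra.
From mathcomp Require Import reals.
From Stdlib Require Import ClassicalEpsilon.
From mathcomp.algebra_tactics Require Import ring.
From mathcomp Require Import zify.
Set Implicit Arguments.
Unset Strict Implicit.
Unset Printing Implicit Defensive.
Import Order.TTheory GRing.Theory Num.Theory.
Local Open Scope ring_scope.

(** In barycentric coordinates [x, y, z] with [z = 1 - x - y], [b_{p,k}] is the restriction
    to [x + y + z = 1] of a form [F] of degree [p] that is harmonic for the operator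
    [d/dx x d/dx + d/dy y d/dy + d/dz z d/dz], which is invariant under permutations of
    the coordinates.  A harmonic form that vanishes on an edge [z = 0] is zero.

    The functions [brefl p k], [3 k + 1 <= p], are linearly independent: a dependency
    yields a rotation invariant combination of the [b_{p,2k}] with [3 k < p], whose form
    of top degree is divisible by a power of [x + y] so high that, by the rotation
    invariance, it must vanish.

    For (a), the three functions [brefl] attached to the vertices of the facet opposite to
    [A_i] cancel when summed over the rotations of that facet, so a dependency between
    the [Q] forces its part with index [i] to vanish on this facet; hence the corresponding
    combination of the [brefl p k] vanishes on an edge.  For (b), the same cancellation
    expresses the generators at one vertex through those at the two others. *)

(** * The forms of [b_{p,k}] in barycentric coordinates *)

(* [(x + y)^k P_k((x - y) / (x + y))], with the division carried out. *)
Definition legform (A : comNzRingType) (k : nat) (x y : A) : A :=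
  \sum_(i < k.+1) ('C(k, i) ^ 2)%:R * ((- y) ^+ i * x ^+ (k - i)).

(** With [w = x + y + z] this is [w^n P_n^{(0,2k+1)}((x + y - z) / w)] times [legform k x y], a form
    of degree [n + k]. The ring is arbitrary so that indeterminates can be substituted. *)
Definition jacform (A : comNzRingType) (n k : nat) (x y z : A) : A :=
  \sum_(i < n.+1) ('C(n, i) * 'C(n + (2 * k + 1), i))%:R
     * ((- z) ^+ i * (x + y) ^+ (n - i)) * legform k x y.

Lemma bpk_jacform (R : realType) (p k : nat) (s t : R) :
  bpk p k s t = jacform (p - k) k s t (1 - s - t).
Proof.
rewrite /bpk /jacobi /hjacobi /jacform -mulr_suml; congr (_ * _).
  apply: eq_bigr => -[i /= hi] _.
  rewrite addn0 bin_sub // -mulrA; congr (_ * (_ ^+ _ * _ ^+ _)); by field.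
apply: eq_bigr => -[i /= hi] _.
rewrite addn0 bin_sub // -mulnn -mulrA; congr (_ * (_ ^+ _ * _ ^+ _)); by field.
Qed.

Lemma legform_scale (A : comNzRingType) (k : nat) (a x y : A) :
  legform k (a * x) (a * y) = a ^+ k * legform k x y.
Proof.
rewrite /legform mulr_sumr; apply: eq_bigr => -[i /= hi] _.
have -> : a ^+ k = a ^+ i * a ^+ (k - i) by rewrite -exprD subnKC.
rewrite -mulrN !exprMn. move: (a ^+ (k - i)) (x ^+ (k - i)) => u v. ring.
Qed.

Lemma jacform_scale (A : comNzRingType) (n k : nat) (a x y z : A) :
  jacform n k (a * x) (a * y) (a * z) = a ^+ (n + k) * jacform n k x y z.
Proof.
rewrite /jacform mulr_sumr; apply: eq_bigr => -[i /= hi] _.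
have -> : a ^+ (n + k) = a ^+ i * a ^+ (n - i) * a ^+ k by rewrite -!exprD subnKC.
rewrite -mulrN -mulrDr legform_scale !exprMn.
move: (a ^+ (n - i)) ((x + y) ^+ (n - i)) => u v; ring.
Qed.

Lemma rmorph_legform (A B : comNzRingType) (f : {rmorphism A -> B}) k x y :
  f (legform k x y) = legform k (f x) (f y).
Proof.
rewrite /legform rmorph_sum; apply: eq_bigr => i _.
by rewrite !rmorphM rmorph_nat !rmorphXn rmorphN.
Qed.

Lemma rmorph_jacform (A B : comNzRingType) (f : {rmorphism A -> B}) n k x y z :
  f (jacform n k x y z) = jacform n k (f x) (f y) (f z).
Proof.
rewrite /jacform rmorph_sum; apply: eq_bigr => i _.
rewrite 3![f (_ * _)]rmorphM rmorph_nat !rmorphXn rmorphN rmorphD.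
by rewrite rmorph_legform.
Qed.

(** * Derivations and the Laplacian in one variable *)

Definition derivation {A : comNzRingType} (D : A -> A) : Prop :=
  {morph D : f g / f + g} /\ (forall f g, D (f * g) = D f * g + f * D g).

Section Derivation.
Variables (A : comNzRingType) (D : A -> A).
Hypothesis derD : derivation D.

Lemma derivationD : {morph D : f g / f + g}. Proof. exact: derD.1. Qed.
Lemma derivationM f g : D (f * g) = D f * g + f * D g. Proof. exact: derD.2. Qed.

Lemma derivation0 : D 0 = 0.
Proof. by apply: (addrI (D 0)); rewrite -derivationD !addr0. Qed.

Lemma derivation1 : D 1 = 0.
Proof. by apply: (addrI (D 1)); rewrite addr0 -[RHS](congr1 D (mul1r 1)) derivationM mul1r mulr1. Qed.

Lemma derivationN f : D (- f) = - D f.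
Proof. by apply: (addrI (D f)); rewrite -derivationD !subrr derivation0. Qed.

Lemma derivation_nat n : D n%:R = 0.
Proof. by elim: n => [|n ih]; rewrite ?derivation0 // -natr1 derivationD ih derivation1 addr0. Qed.

Lemma derivationX f n : D (f ^+ n) = n%:R * f ^+ n.-1 * D f.
Proof.
elim: n => [|n ih]; first by rewrite expr0 derivation1 !mul0r.
rewrite exprS derivationM ih /= -natr1; case: n {ih} => [|n] /=; first by rewrite expr0; ring.
by rewrite exprS; ring.
Qed.

Lemma derivation_sum (I : Type) (r : seq I) (P : pred I) (F : I -> A) :
  D (\sum_(i <- r | P i) F i) = \sum_(i <- r | P i) D (F i).
Proof. by apply: (big_morph D derivationD derivation0). Qed.

Lemma derivation_constM c f : D c = 0 -> D (c * f) = c * D f.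
Proof. by move=> c0; rewrite derivationM c0 mul0r add0r. Qed.

(* [D (x D f)] when [D x = 1]. *)
Definition lapl (x f : A) : A := x * D (D f) + D f.

Lemma lapl_sum x (I : Type) (r : seq I) (P : pred I) (F : I -> A) :
  lapl x (\sum_(i <- r | P i) F i) = \sum_(i <- r | P i) lapl x (F i).
Proof. by rewrite /lapl !derivation_sum mulr_sumr big_split. Qed.

Lemma lapl_constM x c f : D c = 0 -> lapl x (c * f) = c * lapl x f.
Proof. by move=> c0; rewrite /lapl !derivation_constM //; ring. Qed.

Lemma laplD x f g : lapl x (f + g) = lapl x f + lapl x g.
Proof. by rewrite /lapl !derivationD; ring. Qed.

Lemma laplN x f : lapl x (- f) = - lapl x f.
Proof. by rewrite /lapl !derivationN; ring. Qed.

Lemma natr_exprS (x : A) n : n%:R * (x * x ^+ n.-1) = n%:R * x ^+ n.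
Proof. by case: n => [|n]; rewrite ?mul0r // exprS. Qed.

Lemma lapl_expr x n : D x = 1 -> lapl x (x ^+ n) = (n ^ 2)%:R * x ^+ n.-1.
Proof.
move=> Dx; rewrite /lapl derivationX Dx mulr1 derivation_constM ?derivation_nat //.
rewrite derivationX Dx mulr1; case: n => [|n] /=; first by ring.
rewrite -mulnn natrM -natr1.
have := natr_exprS x n; move: (x ^+ n.-1) (x ^+ n) => u v e.
transitivity ((n%:R + 1) * (n%:R * (x * u)) + (n%:R + 1) * v); first by ring.
by rewrite e; ring.
Qed.

Lemma lapl_exprN x n : D x = 1 -> lapl x ((- x) ^+ n) = - (n ^ 2)%:R * (- x) ^+ n.-1.
Proof.
move=> Dx; rewrite exprNn lapl_constM; last first.
  by rewrite derivationX derivationN derivation1 oppr0 mulr0.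
rewrite lapl_expr // [(- x) ^+ n.-1]exprNn.
by case: n => [|n] /=; [rewrite !mul0r oppr0 mul0r mulr0 | rewrite exprS; ring].
Qed.

End Derivation.

(** * Harmonicity of the forms *)

Section Harmonic.
Variables (A : comNzRingType) (D1 D2 D3 : A -> A) (x y z : A).
Hypotheses (d1 : derivation D1) (d2 : derivation D2) (d3 : derivation D3).
Hypotheses (D1x : D1 x = 1) (D1y : D1 y = 0) (D1z : D1 z = 0).
Hypotheses (D2x : D2 x = 0) (D2y : D2 y = 1) (D2z : D2 z = 0).
Hypotheses (D3x : D3 x = 0) (D3y : D3 y = 0) (D3z : D3 z = 1).

Let derM := (derivationM d1, derivationM d2, derivationM d3).
Let derD := (derivationD d1, derivationD d2, derivationD d3).
Let derN := (derivationN d1, derivationN d2, derivationN d3).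
Let derX := (derivationX d1, derivationX d2, derivationX d3).
Let der_nat := (derivation_nat d1, derivation_nat d2, derivation_nat d3).
Let der_sum := (derivation_sum d1, derivation_sum d2, derivation_sum d3).
Let der_natM n := (fun f => derivation_constM d1 f (derivation_nat d1 n),
  fun f => derivation_constM d2 f (derivation_nat d2 n),
  fun f => derivation_constM d3 f (derivation_nat d3 n)).
Let lap_sum := (lapl_sum d1, lapl_sum d2, lapl_sum d3).
Let lap_constM := (lapl_constM d1, lapl_constM d2, lapl_constM d3).
Let lap_natM n := (fun v f => lapl_constM d1 v f (derivation_nat d1 n),
  fun v f => lapl_constM d2 v f (derivation_nat d2 n),
  fun v f => lapl_constM d3 v f (derivation_nat d3 n)).
Let lap_expr := (fun n => lapl_expr d1 n D1x, fun n => lapl_expr d2 n D2y).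
Let lap_exprN := (fun n => lapl_exprN d2 n D2y, fun n => lapl_exprN d3 n D3z).

(** Euler's identity, needed for the cross terms of a product with a power of [x + y]. *)
Lemma legform_euler k :
  x * D1 (legform k x y) + y * D2 (legform k x y) = k%:R * legform k x y.
Proof.
rewrite /legform !der_sum // !mulr_sumr -big_split; apply: eq_bigr => -[i /= hi] _.
rewrite !der_natM // !derM // !derX //.
rewrite !derN // D1x D1y D2x D2y.
have -> : k%:R = i%:R + (k - i)%:R :> A by rewrite -natrD subnKC.
have := natr_exprS (- y) i; have := natr_exprS x (k - i).
move: ((- y) ^+ i.-1) ((- y) ^+ i) (x ^+ (k - i).-1) (x ^+ (k - i)) => u v u' v' e e'.
move: ((k - i)%:R : A) (i%:R : A) (('C(k, i) ^ 2)%:R : A) e e' => a b c e e'.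
transitivity (c * (v * (a * (x * u')) + v' * (b * (- y * u)))); first by ring.
by rewrite e e'; ring.
Qed.

(** The sums telescope: the [x] part on the monomial of index [i] cancels the [y] part on that of
    index [i + 1], as [C(k, i + 1) (i + 1) = C(k, i) (k - i)]. *)
Lemma legform_harmonic k :
  lapl D1 x (legform k x y) + lapl D2 y (legform k x y) = 0.
Proof.
rewrite /legform !lap_sum //.
have e1 (i : 'I_k.+1) : true ->
    lapl D1 x (('C(k, i) ^ 2)%:R * ((- y) ^+ i * x ^+ (k - i)))
    = (('C(k, i) * (k - i)) ^ 2)%:R * ((- y) ^+ i * x ^+ (k - i).-1).
  move=> _; rewrite !lap_constM ?der_nat ?lap_expr //; last first.
    by rewrite derX // derN // D1y oppr0 mulr0.
  by rewrite expnMn natrM; ring.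
have e2 (i : 'I_k.+1) : true ->
    lapl D2 y (('C(k, i) ^ 2)%:R * ((- y) ^+ i * x ^+ (k - i)))
    = - (('C(k, i) * i) ^ 2)%:R * ((- y) ^+ i.-1 * x ^+ (k - i)).
  move=> _; rewrite mulrA mulrAC -mulrA mulrA !lap_constM ?der_nat //; last first.
    by rewrite derM // der_nat // derX // D2x !mulr0 mul0r addr0.
  by rewrite lap_exprN // expnMn natrM; ring.
rewrite (eq_bigr _ e1) (eq_bigr _ e2) big_ord_recr big_ord_recl /=.
rewrite subnn muln0 mul0r addr0 muln0 oppr0 mul0r add0r -big_split big1 //= => i _.
rewrite /bump /= add1n subnS.
have -> : ('C(k, i.+1) * i.+1 = 'C(k, i) * (k - i))%N.
  by rewrite mulnC mul_bin_left mulnC.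
by rewrite mulNr subrr.
Qed.

(** By Euler's identity and harmonicity of the Legendre factor [H], the [x] and [y] parts turn
    [(x + y)^m H] into [m (m + 2 k + 1) (x + y)^(m - 1) H]. The [z] part lowers the power of [- z],
    and the sums telescope again. *)
Lemma jacform_harmonic n k :
  let F := jacform n k x y z in lapl D1 x F + lapl D2 y F + lapl D3 z F = 0.
Proof.
rewrite /jacform !lap_sum //.
set H := legform k x y.
have D3H : D3 H = 0.
  rewrite /H /legform der_sum // big1 // => i _.
  rewrite der_natM ?der_nat // derM // !derX //.
  by rewrite derN // D3x D3y; ring.
have e12 (i : 'I_n.+1) : true ->
   lapl D1 x (('C(n, i) * 'C(n + (2 * k + 1), i))%:R
     * ((- z) ^+ i * (x + y) ^+ (n - i)) * H)
   + lapl D2 y (('C(n, i) * 'C(n + (2 * k + 1), i))%:R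
     * ((- z) ^+ i * (x + y) ^+ (n - i)) * H)
   = ('C(n, i) * 'C(n + (2 * k + 1), i) * ((n - i) * (n - i + (2 * k + 1))))%:R
     * ((- z) ^+ i * (x + y) ^+ (n - i).-1) * H.
  move=> _; rewrite -!mulrA !lap_natM //.
  rewrite (lapl_constM d1) 1?(lapl_constM d2) //; first last.
  - by rewrite derX // derN // D1z oppr0 mulr0.
  - by rewrite derX // derN // D2z oppr0 mulr0.
  rewrite -!mulrDr [in RHS]natrM -!mulrA; congr (_ * _); rewrite [RHS]mulrCA; congr (_ * _).
  move: (n - i)%N => m.
  have := legform_euler k; have := legform_harmonic k; rewrite -/H /lapl.
  rewrite !derM // !derX // !derD // D1x D1y D2x D2y.
  rewrite addr0 add0r !mulr1 !derM !der_nat !derX !derD !D1x !D1y !D2x !D2y.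
  rewrite addr0 add0r !mulr1 !mul0r !add0r.
  have := natr_exprS (x + y) m; have := natr_exprS (x + y) m.-1.
  have : m%:R * m.-1%:R = m%:R * (m%:R - 1) :> A.
    by case: (m) => [|m']; rewrite ?mul0r // -natr1 addrK.
  rewrite natrM natrD natrD natrM.
  move: ((x + y) ^+ m) ((x + y) ^+ m.-1) ((x + y) ^+ m.-1.-1) => v v1 v2.
  move: {H D3H} (H) (D1 H) (D2 H) (D1 (D1 H)) (D2 (D2 H)) m%:R m.-1%:R k%:R.
  move=> h h1 h2 h11 h22 a a1 b ea e1 e0 eh ee.
  transitivity (a * (a1 * ((x + y) * v2)) * h + 2%:R * a * v1 * (x * h1 + y * h2)
     + v * (x * h11 + h1 + (y * h22 + h2)) + 2%:R * a * v1 * h); first by ring.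
  rewrite eh ee e1.
  transitivity (a * a1 * v1 * h + 2%:R * a * v1 * (b * h) + 2%:R * a * v1 * h); first by ring.
  by rewrite ea; ring.
have e3 (i : 'I_n.+1) : true ->
   lapl D3 z (('C(n, i) * 'C(n + (2 * k + 1), i))%:R
     * ((- z) ^+ i * (x + y) ^+ (n - i)) * H)
   = - ('C(n, i) * 'C(n + (2 * k + 1), i) * (i * i))%:R
     * ((- z) ^+ i.-1 * (x + y) ^+ (n - i)) * H.
  move=> _; rewrite [X in lapl _ _ X](_ : _ = ('C(n, i) * 'C(n + (2 * k + 1), i))%:R
     * (((x + y) ^+ (n - i) * H) * (- z) ^+ i)); last by ring.
  rewrite !lap_constM ?der_nat //; last first.
    by rewrite derM // D3H derX // derD // D3x D3y; ring.
  by rewrite lap_exprN // -mulnn !natrM; ring.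
rewrite -big_split /= (eq_bigr _ e12) (eq_bigr _ e3) big_ord_recr big_ord_recl /=.
rewrite subnn !muln0 !mul0r addr0 oppr0 !mul0r add0r -big_split big1 //= => -[i /= hi] _.
rewrite /bump /= add1n subnS.
have -> : ('C(n, i.+1) * 'C(n + (2 * k + 1), i.+1) * (i.+1 * i.+1)
   = 'C(n, i) * 'C(n + (2 * k + 1), i) * ((n - i) * (n - i + (2 * k + 1))))%N.
  rewrite mulnACA ![('C(_, i.+1) * _)%N]mulnC !mul_bin_left [RHS]mulnACA.
  by rewrite ![('C(_, i) * _)%N]mulnC addnBAC // ltnW.
by rewrite !mulNr subrr.
Qed.

End Harmonic.

(** * Polynomial identities and harmonic polynomials in nested polynomial rings *)

Lemma poly_eq0_infinite (A : idomainType) (P : {poly A}) (f : nat -> A) :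
  injective f -> (forall n, P.[f n] = 0) -> P = 0.
Proof.
move=> inj_f Pf; apply/eqP; apply/negPn/negP => P0.
have := max_poly_roots (rs := [seq f i | i <- iota 0 (size P)]) P0.
rewrite size_map size_iota ltnn => /(_ _ _)/negP; case=> //.
  by apply/allP => _ /mapP[n _ ->]; apply/rootP.
by rewrite map_inj_uniq // iota_uniq.
Qed.

(** The positive integers already give infinitely many points in each variable; positivity is what
    the points of an edge provide. *)
Lemma poly2_eq0 (R : numDomainType) (P : {poly {poly R}}) :
  (forall x y : R, 0 < x -> 0 < y -> P.[y%:P].[x] = 0) -> P = 0.
Proof.
have inj_S : injective (fun n => n.+1%:R : R).
  by move=> m n /eqP; rewrite eqr_nat => /eqP[].
move=> Pxy; apply: (poly_eq0_infinite (f := fun n => (n.+1%:R)%:P)).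
  by move=> m n /polyC_inj/inj_S.
move=> n; apply: (poly_eq0_infinite inj_S) => m.
by rewrite Pxy ?ltr0Sn.
Qed.

Lemma derivation_deriv (A : comNzRingType) : derivation (@deriv A).
Proof. by split=> f g; [exact: derivD | exact: derivM]. Qed.

Section MapDerivation.
Variables (A : comNzRingType) (D : A -> A).
Hypothesis derD : derivation D.

Lemma coef_map_derivation (P : {poly A}) i : (map_poly D P)`_i = D P`_i.
Proof. exact: coef_map_id0 (derivation0 derD). Qed.

Lemma derivation_map_poly : derivation (map_poly D).
Proof.
split=> f g; apply/polyP => i.
  by rewrite coefD !coef_map_derivation coefD derivationD.
rewrite coefD !coefM coef_map_derivation coefM derivation_sum // -big_split.
by apply: eq_bigr => j _; rewrite derivationM // !coef_map_derivation.
Qed.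

Lemma map_derivationX : map_poly D 'X = 0.
Proof.
apply/polyP => i; rewrite coef_map_derivation coefX coef0.
by rewrite derivation_nat.
Qed.

Lemma map_derivationC a : map_poly D a%:P = (D a)%:P.
Proof.
apply/polyP => i; rewrite coef_map_derivation !coefC.
by case: eqP => // _; rewrite derivation0.
Qed.

Lemma coef_lapl_map (P : {poly A}) (a : A) i :
  (lapl (map_poly D) a%:P P)`_i = lapl D a P`_i.
Proof. by rewrite /lapl coefD coefCM !coef_map_derivation. Qed.

End MapDerivation.

Lemma coef_lapl_deriv (A : comNzRingType) (P : {poly A}) i :
  (lapl (@deriv A) 'X P)`_i = (i.+1 ^ 2)%:R * P`_i.+1.
Proof.
rewrite /lapl coefD coefXM; case: i => [|i] /=; first by rewrite add0r coef_deriv mul1r.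
by rewrite !coef_deriv -mulrnA -mulrnDr addnC -mulnS mulnn mulr_natl.
Qed.

(* The coefficient of [z^(i+1)] is [- (i+1)^(-2)] times the image of that of [z^i] under
   the Laplacian in the other two variables. *)
Lemma harmonic_eq0 (R : numDomainType) (P : {poly {poly {poly R}}}) :
  lapl (map_poly (map_poly (@deriv R))) 'X%:P%:P P
    + lapl (map_poly (@deriv {poly R})) 'X%:P P + lapl (@deriv {poly {poly R}}) 'X P = 0 ->
  P.[0] = 0 -> P = 0.
Proof.
have dR := derivation_deriv R.
have dRR := derivation_deriv {poly R}.
have dm := derivation_map_poly dR.
move=> harmP P0; apply/polyP; elim=> [|i ih]; first by rewrite -horner_coef0 P0 coef0.
move: harmP => /(congr1 (fun q : {poly {poly {poly R}}} => q`_i)).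
rewrite 2!coefD (coef_lapl_map dm) (coef_lapl_map dRR) coef_lapl_deriv ih !coef0.
rewrite /lapl !(derivation0 dm) !(derivation0 dRR) !mulr0 !add0r => /eqP.
rewrite mulf_eq0 -(rmorph_nat (@polyC {poly R})) polyC_eq0.
by rewrite -(rmorph_nat (@polyC R)) polyC_eq0 pnatr_eq0 expn_eq0 /= => /eqP.
Qed.

(** * Combinations of even index and their images under [Pi] *)

Definition evensum (A : comNzRingType) (c : nat -> A) (p d : nat) (x y z : A) : A :=
  \sum_(k < d) c k * jacform (p - 2 * k) (2 * k) x y z.

(** In barycentric coordinates [Pi] combines cyclic permutations. This is three times its result,
    which avoids a division in [A]. *)
Definition reflsum (A : comNzRingType) (c : nat -> A) (p d : nat) (x y z : A) : A :=
  2 * evensum c p d x y z - evensum c p d y z x - evensum c p d z x y.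

Lemma rmorph_evensum (A B : comNzRingType) (f : {rmorphism A -> B}) c p d x y z :
  f (evensum c p d x y z) = evensum (f \o c) p d (f x) (f y) (f z).
Proof.
rewrite /evensum rmorph_sum; apply: eq_bigr => k _.
by rewrite rmorphM rmorph_jacform.
Qed.

Lemma rmorph_reflsum (A B : comNzRingType) (f : {rmorphism A -> B}) c p d x y z :
  f (reflsum c p d x y z) = reflsum (f \o c) p d (f x) (f y) (f z).
Proof. by rewrite /reflsum !rmorphB rmorphM rmorph_nat !rmorph_evensum. Qed.

Lemma evensum_scale (A : comNzRingType) (c : nat -> A) (p d : nat) (a x y z : A) :
  (forall k, (k < d)%N -> (2 * k <= p)%N) ->
  evensum c p d (a * x) (a * y) (a * z) = a ^+ p * evensum c p d x y z.
Proof.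
move=> hd; rewrite /evensum mulr_sumr; apply: eq_bigr => -[k /= /hd hk] _.
by rewrite jacform_scale subnK // mulrCA.
Qed.

Lemma reflsum_scale (A : comNzRingType) (c : nat -> A) (p d : nat) (a x y z : A) :
  (forall k, (k < d)%N -> (2 * k <= p)%N) ->
  reflsum c p d (a * x) (a * y) (a * z) = a ^+ p * reflsum c p d x y z.
Proof. by move=> hd; rewrite /reflsum !evensum_scale //; ring. Qed.

Lemma sum_brefl (R : realType) (c : nat -> R) (p d : nat) (s t : R) :
  \sum_(k < d) c k * brefl p k s t = reflsum c p d s t (1 - s - t) / 3.
Proof.
rewrite /reflsum /evensum mulr_sumr -!sumrB mulr_suml; apply: eq_bigr => k _.
rewrite /brefl /Pi !bpk_jacform.
have -> : 1 - t - (1 - s - t) = s by ring.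
have -> : 1 - (1 - s - t) - s = t by ring.
by field.
Qed.

(** * Linear independence of the functions [brefl p k] *)

(** [2^n] times the leading coefficient of [P_n^{(0,2k+1)}]. *)
Definition topcoef (n k : nat) : nat := \sum_(i < n.+1) 'C(n, i) * 'C(n + (2 * k + 1), i).

Lemma topcoef_gt0 n k : (0 < topcoef n k)%N.
Proof. by rewrite /topcoef big_ord_recl !bin0. Qed.

(** On [x + y + z = 0] a form gives the top degree part of its restriction to [x + y + z = 1]; here
    [- z = x + y] merges all terms of the Jacobi sum into one power. *)
Lemma jacform_infinity (A : comNzRingType) (n k : nat) (x y : A) :
  jacform n k x y (- (x + y)) = (topcoef n k)%:R * (x + y) ^+ n * legform k x y.
Proof.
rewrite /jacform /topcoef natr_sum -!mulr_suml; congr (_ * _).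
rewrite mulr_suml; apply: eq_bigr => -[i /= hi] _.
by rewrite opprK -exprD subnKC.
Qed.

Lemma evensum_infinity (A : comNzRingType) (c : nat -> A) (p d : nat) (x y : A) :
  evensum c p d x y (- (x + y)) =
  \sum_(k < d) c k * (topcoef (p - 2 * k) (2 * k))%:R
     * ((x + y) ^+ (p - 2 * k) * legform (2 * k) x y).
Proof. by apply: eq_bigr => k _; rewrite jacform_infinity !mulrA. Qed.

(** At this point [x + y = 0] and all terms have the same sign; hence [x + y] does not divide the
    Legendre factor. *)
Lemma legformN1_neq0 (R : numDomainType) k : legform k (- 1) 1 != 0 :> R.
Proof.
have -> : legform k (- 1) 1 = (\sum_(i < k.+1) 'C(k, i) ^ 2)%:R * (- 1) ^+ k :> R.
  rewrite natr_sum mulr_suml; apply: eq_bigr => -[i /= hi] _.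
  by rewrite -exprD subnKC.
rewrite mulf_neq0 ?signr_eq0 // pnatr_eq0 -lt0n big_ord_recl bin0.
by rewrite addSn.
Qed.

Lemma size_legform_le (R : idomainType) k (P Q : {poly R}) :
  (size P <= 2)%N -> (size Q <= 2)%N -> (size (legform k P Q) <= k.+1)%N.
Proof.
move=> sP sQ; apply: (leq_trans (size_sum _ _ _)); apply/bigmax_leqP => -[i /= hi] _.
have sz (S : {poly R}) m : (size S <= 2)%N -> (size (S ^+ m) <= m.+1)%N.
  move=> sS; apply: (leq_trans (size_poly_exp_leq _ _)); nia.
rewrite mulr_natl -scaler_nat; apply: (leq_trans (size_scale_leq _ _)).
apply: (leq_trans (size_polyMleq _ _)).
have := sz (- Q) i; rewrite size_polyN => /(_ sQ) h1; have h2 := sz _ (k - i)%N sP.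
by move: h1 h2; move: (size _) (size _) => a b h1 h2; lia.
Qed.

(** The factor of [c k] vanishes at [a] to the exact order [p - 2 k], smallest for the last index.
    Dividing by that power and evaluating at [a] isolates the last coefficient; induction gives the
    others. *)
Lemma distinct_order_indep (R : fieldType) (a : R) (P : nat -> {poly R}) (c : nat -> R) (p d : nat) :
  (forall k, (P k).[a] != 0) -> (forall k, (k < d)%N -> (2 * k <= p)%N) ->
  \sum_(k < d) (c k)%:P * (('X - a%:P) ^+ (p - 2 * k) * P k) = 0 ->
  forall k, (k < d)%N -> c k = 0.
Proof.
move=> Pa; elim: d => [//|d ih] hd; rewrite big_ord_recr /=.
have cd : \sum_(k < d) (c k)%:P * (('X - a%:P) ^+ (p - 2 * k) * P k)
    = ('X - a%:P) ^+ (p - 2 * d)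
      * \sum_(k < d) (c k)%:P * (('X - a%:P) ^+ (2 * (d - k)) * P k).
  rewrite mulr_sumr; apply: eq_bigr => -[k /= hk] _.
  have -> : (p - 2 * k = p - 2 * d + 2 * (d - k))%N by have := hd d (leqnn _); lia.
  by rewrite exprD -!mulrA mulrCA.
move=> e; have cd0 : c d = 0.
  move: e; rewrite cd mulrCA -mulrDr => /eqP.
  rewrite mulf_eq0 expf_eq0 polyXsubC_eq0 andbF /= => /eqP/(congr1 (horner^~ a)).
  rewrite hornerD horner_sum big1 => [|[k /= hk] _]; last first.
    rewrite !hornerM horner_exp hornerXsubC subrr expr0n.
    by rewrite (_ : (2 * (d - k) == 0)%N = false) ?mul0r ?mulr0 //; lia.
  by rewrite add0r hornerM hornerC horner0 => /eqP; rewrite mulf_eq0 (negPf (Pa d)) orbF => /eqP.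
move=> k; rewrite ltnS leq_eqVlt => /orP[/eqP-> //|].
apply: ih => [j hj|]; first by apply: hd; rewrite ltnW.
by move: e; rewrite cd0 mul0r addr0.
Qed.

(* The form of top degree of a rotation invariant combination of [b_{p,2k}], [k <= N],
   is divisible by [(x + y)^e], hence by [x^e y^e (x + y)^e], where [e = p - 2 N]. As
   [3 e > p], it vanishes. *)
Lemma evensum_indep (R : numFieldType) (c : nat -> R) (p d : nat) :
  (forall k, (k < d)%N -> (3 * k + 1 <= p)%N) ->
  (forall x y, evensum c p d x y (- (x + y)) = evensum c p d y (- (x + y)) x) ->
  forall k, (k < d)%N -> c k = 0.
Proof.
case: d => [//|N] hd rot.
have hN : (3 * N + 1 <= p)%N by apply: hd.
pose C := polyC \o c; pose e := (p - 2 * N)%N.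
have inj_nat : injective (fun n => n%:R : R) by move=> m n /eqP; rewrite eqr_nat => /eqP.
(* The hypothesis concerns scalars; evaluation at the natural numbers transfers it to
   polynomials. *)
have rotP (P Q : {poly R}) :
    evensum C p N.+1 P Q (- (P + Q)) = evensum C p N.+1 Q (- (P + Q)) P.
  apply/eqP; rewrite -subr_eq0; apply/eqP; apply: (poly_eq0_infinite inj_nat) => n.
  rewrite -[LHS]/(horner_eval n%:R _) rmorphB !rmorph_evensum rmorphN rmorphD /=.
  apply/eqP; rewrite subr_eq0; apply/eqP.
  have cE : (fun k => horner_eval n%:R (C k)) =1 c by move=> k; rewrite /horner_eval hornerC.
  rewrite -!/(comp _ _); transitivity (evensum c p N.+1 P.[n%:R] Q.[n%:R] (- (P.[n%:R] + Q.[n%:R]))).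
    by apply: eq_bigr => k _; rewrite /= cE.
  by rewrite rot; apply: eq_bigr => k _; rewrite /= cE.
pose T := evensum C p N.+1 'X 1 (- ('X + 1)).
have dvd_T (P Q : {poly R}) : (P + Q) ^+ e %| evensum C p N.+1 P Q (- (P + Q)).
  rewrite evensum_infinity; elim/big_ind: _ => [|u v|[k /= hk] _]; rewrite ?dvdp0 //.
    exact: dvdp_add.
  rewrite mulrCA dvdp_mulr // /e.
  by apply: dvdp_exp2l; lia.
have T2 : T = evensum C p N.+1 1 (- ('X + 1)) (- (1 + - ('X + 1))).
  by rewrite /T rotP; congr evensum; ring.
(* With [y = 1] the factor [y^e] shows only as a drop of the degree: the first two arguments add up
   to [- 1], which leaves degree at most [2 N]. *)
have T3 : T = evensum C p N.+1 (- ('X + 1)) 'X (- (- ('X + 1) + 'X)).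
  by rewrite T2 rotP; congr evensum; ring.
have T0 : T = 0.
  apply/eqP; apply/negPn/negP => Tn0.
  have d1 : ('X - (-1)%:P) ^+ e %| T.
    by have := dvd_T 'X 1; rewrite polyCN opprK polyC1.
  have d2 : ('X - 0%:P) ^+ e %| T.
    have := dvd_T 1 (- ('X + 1)); rewrite -T2 subr0.
    have -> : 1 - ('X + 1) = - 'X :> {poly R} by ring.
    rewrite exprNn => h; apply: dvdp_trans h.
    by rewrite dvdp_mull.
  have cop : coprimep (('X - (-1)%:P) ^+ e) (('X - 0%:P) ^+ e : {poly R}).
    by apply/coprimep_expl/coprimep_expr/coprimep_XsubC2; rewrite sub0r opprK oner_neq0.
  have : ('X - (-1)%:P) ^+ e * ('X - 0%:P) ^+ e %| T by rewrite Gauss_dvdp ?d1.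
  (* Degrees would give [2 e <= 2 N], against [3 N < p]. *)
  move=> /(dvdp_leq Tn0); rewrite size_mul ?expf_neq0 ?polyXsubC_eq0 // !size_exp_XsubC.
  suff sT : (size T <= (2 * N).+1)%N.
    by move: sT; move: (size T) => m; rewrite /e; clear -hN; lia.
  rewrite T3 evensum_infinity; apply: (leq_trans (size_sum _ _ _)).
  apply/bigmax_leqP => -[k /= hk] _.
  rewrite [X in (size (polyseq X) <= _)%N](_ : _ = (c k * (topcoef (p - 2 * k) (2 * k))%:R * (- 1) ^+ (p - 2 * k))
      *: legform (2 * k) (- ('X + 1)) 'X); last first.
    have -> : - ('X + 1) + 'X = - 1 :> {poly R} by ring.
    by rewrite -mul_polyC !polyCM polyC_natr polyC_exp polyCN polyC1 mulrA.
  apply: (leq_trans (size_scale_leq _ _)).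
  rewrite (leq_trans (size_legform_le _ _ _)) //; last by lia.
    by rewrite size_polyN -polyC1 size_XaddC.
  by rewrite size_polyX.
pose c' k := c k * (topcoef (p - 2 * k) (2 * k))%:R.
move=> k hk; have : c' k = 0.
  apply: (distinct_order_indep (a := -1) (P := fun k => legform (2 * k) 'X 1)
    (p := p) (d := N.+1)) => //.
  - move=> j; rewrite -[X in X != _]/(horner_eval (-1) _) rmorph_legform rmorph1.
    by rewrite /= /horner_eval hornerX legformN1_neq0.
  - by move=> j /hd; lia.
  rewrite -[RHS]T0 /T evensum_infinity; apply: eq_bigr => j _.
  by rewrite /c' polyCM polyC_natr polyCN opprK polyC1.
move=> /eqP; rewrite mulf_eq0 pnatr_eq0 [_ == 0%N]gtn_eqF ?topcoef_gt0 // orbF.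
by move=> /eqP.
Qed.

(** Subtracting a rotated copy of the hypothesis makes [evensum] rotation invariant on
    [x + y + z = 1]. Homogeneity extends this to [x + y + z != 0], and a polynomial identity in [z]
    to [x + y + z = 0], as [evensum_indep] requires. *)
Lemma reflsum_indep (R : numFieldType) (c : nat -> R) (p d : nat) :
  (forall k, (k < d)%N -> (3 * k + 1 <= p)%N) ->
  (forall x y z, x + y + z = 1 -> reflsum c p d x y z = 0) ->
  forall k, (k < d)%N -> c k = 0.
Proof.
move=> hd refl0; apply: (evensum_indep hd) => x y; have hd2 k : (k < d)%N -> (2 * k <= p)%N.
  by move/hd; lia.
have rot z : x + y + z != 0 -> evensum c p d x y z = evensum c p d y z x.
  move=> w0; set w := x + y + z in w0.
  have sc u v u' : evensum c p d u v u' = w ^+ p * evensum c p d (u / w) (v / w) (u' / w).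
    by rewrite -evensum_scale // ![w * _]mulrC !divfK.
  rewrite (sc x y z) (sc y z x); congr (_ * _).
  have w1 : x / w + y / w + z / w = 1 by rewrite -!mulrDl divff.
  move: (x / w) (y / w) (z / w) w1 => {sc w w0 x y z} x y z xyz.
  have := refl0 x y z xyz; have := refl0 y z x; rewrite /reflsum addrC addrA => /(_ xyz).
  move: (evensum c p d x y z) (evensum c p d y z x) (evensum c p d z x y) => u v t e1 e2.
  have : 3 * (u - v) = 0.
    transitivity ((2 * u - v - t) - (2 * v - t - u)); first by ring.
    by rewrite e1 e2 subrr.
  by move=> /eqP; rewrite mulf_eq0 pnatr_eq0 /= subr_eq0 => /eqP.
pose C := polyC \o c.
have inj_nat : injective (fun n => n.+1%:R - (x + y) : R).
  by move=> m n /addIr /eqP; rewrite eqr_nat => /eqP[].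
have : evensum C p d x%:P y%:P 'X - evensum C p d y%:P 'X x%:P = 0.
  apply: (poly_eq0_infinite inj_nat) => n; set z := n.+1%:R - (x + y).
  rewrite -[LHS]/(horner_eval z _) rmorphB !rmorph_evensum /= /horner_eval !hornerC hornerX.
  have cE : (fun k => horner_eval z (C k)) =1 c by move=> k; rewrite /horner_eval hornerC.
  have zE (a b a' : R) : evensum (horner_eval z \o C) p d a b a' = evensum c p d a b a'.
    by apply: eq_bigr => k _; rewrite /= cE.
  by rewrite !zE rot ?subrr // /z addrC subrK pnatr_eq0.
move=> /eqP; rewrite subr_eq0 => /eqP/(congr1 (horner_eval (- (x + y)))).
rewrite !rmorph_evensum /= /horner_eval !hornerC hornerX => e.
transitivity (evensum (horner_eval (- (x + y)) \o C) p d x y (- (x + y))).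
  by apply: eq_bigr => k _; rewrite /= /horner_eval hornerC.
by rewrite e; apply: eq_bigr => k _; rewrite /= /horner_eval hornerC.
Qed.

(** * Harmonic combinations that vanish on an edge *)

Lemma evensum_harmonic (A : comNzRingType) (D1 D2 D3 : A -> A) (c : nat -> A) p d x y z :
  derivation D1 -> derivation D2 -> derivation D3 ->
  D1 x = 1 -> D1 y = 0 -> D1 z = 0 -> D2 x = 0 -> D2 y = 1 -> D2 z = 0 ->
  D3 x = 0 -> D3 y = 0 -> D3 z = 1 ->
  (forall k, [/\ D1 (c k) = 0, D2 (c k) = 0 & D3 (c k) = 0]) ->
  let F := evensum c p d x y z in lapl D1 x F + lapl D2 y F + lapl D3 z F = 0.
Proof.
move=> d1 d2 d3 D1x D1y D1z D2x D2y D2z D3x D3y D3z Dc.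
rewrite /evensum (lapl_sum d1) (lapl_sum d2) (lapl_sum d3) -!big_split big1 //= => k _.
have [D1c D2c D3c] := Dc k.
rewrite (lapl_constM d1) // (lapl_constM d2) // (lapl_constM d3) // -!mulrDr.
by rewrite jacform_harmonic ?mulr0.
Qed.

(** The operator is unchanged when the pairs [(x, D1)], [(y, D2)], [(z, D3)] are permuted
    cyclically, so each rotated summand is harmonic. *)
Lemma reflsum_harmonic (A : comNzRingType) (D1 D2 D3 : A -> A) (c : nat -> A) p d x y z :
  derivation D1 -> derivation D2 -> derivation D3 ->
  D1 x = 1 -> D1 y = 0 -> D1 z = 0 -> D2 x = 0 -> D2 y = 1 -> D2 z = 0 ->
  D3 x = 0 -> D3 y = 0 -> D3 z = 1 ->
  (forall k, [/\ D1 (c k) = 0, D2 (c k) = 0 & D3 (c k) = 0]) ->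
  let F := reflsum c p d x y z in lapl D1 x F + lapl D2 y F + lapl D3 z F = 0.
Proof.
move=> d1 d2 d3 D1x D1y D1z D2x D2y D2z D3x D3y D3z Dc F.
have Dc' k : [/\ D2 (c k) = 0, D3 (c k) = 0 & D1 (c k) = 0] by case: (Dc k).
have Dc'' k : [/\ D3 (c k) = 0, D1 (c k) = 0 & D2 (c k) = 0] by case: (Dc k).
have := evensum_harmonic p d d1 d2 d3 D1x D1y D1z D2x D2y D2z D3x D3y D3z Dc.
have := evensum_harmonic p d d2 d3 d1 D2y D2z D2x D3y D3z D3x D1y D1z D1x Dc'.
have := evensum_harmonic p d d3 d1 d2 D3z D3x D3y D1z D1x D1y D2z D2x D2y Dc''.
rewrite /= /F /reflsum.
rewrite 2!(laplD d1) 2!(laplD d2) 2!(laplD d3) !(laplN d1) !(laplN d2) !(laplN d3).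
rewrite (lapl_constM d1 _ _ (derivation_nat d1 2)) (lapl_constM d2 _ _ (derivation_nat d2 2)).
rewrite (lapl_constM d3 _ _ (derivation_nat d3 2)).
have lin (a b u a' b' u' a'' b'' u'' : A) :
    u'' + a'' + b'' = 0 -> b' + u' + a' = 0 -> a + b + u = 0 ->
    2 * a - a' - a'' + (2 * b - b' - b'') + (2 * u - u' - u'') = 0.
  move=> e3 e2 e1.
  transitivity (2 * (a + b + u) - (b' + u' + a') - (u'' + a'' + b'')); first by ring.
  by rewrite e1 e2 e3; ring.
exact: lin.
Qed.

(** The form of the combination is harmonic and vanishes on [z = 0], so it is zero and
    [reflsum_indep] applies. *)
Lemma edge_indep (R : realType) (c : nat -> R) (p d : nat) :
  (forall k, (k < d)%N -> (3 * k + 1 <= p)%N) ->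
  (forall t, 0 <= t <= 1 -> \sum_(k < d) c k * brefl p k t (1 - t) = 0) ->
  forall k, (k < d)%N -> c k = 0.
Proof.
move=> hd edge0; have hd2 k : (k < d)%N -> (2 * k <= p)%N by move/hd; lia.
pose C k := (c k)%:P%:P%:P : {poly {poly {poly R}}}.
(* [z] is the outermost indeterminate, since [harmonic_eq0] expands in powers of it. *)
pose x : {poly {poly {poly R}}} := 'X%:P%:P.
pose y : {poly {poly {poly R}}} := 'X%:P.
pose z : {poly {poly {poly R}}} := 'X.
pose P := reflsum C p d x y z.
have evP (a b b' : R) : P.[b'%:P%:P].[b%:P].[a] = reflsum c p d a b b'.
  rewrite -[LHS]/(horner_eval a (horner_eval b%:P (horner_eval b'%:P%:P P))) !rmorph_reflsum /=.
  rewrite /horner_eval /x /y /z !hornerC !hornerX !hornerC.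
  rewrite /reflsum; congr (_ * _ - _ - _); apply: eq_bigr => k _;
    by rewrite /= /horner_eval !hornerC.
have P0 : P = 0.
  have dR := derivation_deriv R.
  have dRR := derivation_deriv {poly R}.
  have dm := derivation_map_poly dR.
  apply: harmonic_eq0.
    apply: reflsum_harmonic => //.
    - exact: derivation_map_poly dm.
    - exact: derivation_map_poly dRR.
    - exact: derivation_deriv.
    - by rewrite (map_derivationC dm) (map_derivationC dR) derivX !polyC1.
    - by rewrite (map_derivationC dm) (map_derivationX dR) polyC0.
    - by rewrite (map_derivationX dm).
    - by rewrite (map_derivationC dRR) derivC polyC0.
    - by rewrite (map_derivationC dRR) derivX polyC1.
    - by rewrite (map_derivationX dRR).
    - by rewrite derivC.
    - by rewrite derivC.
    - by rewrite derivX.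
    move=> k; rewrite /C (map_derivationC dm) (map_derivationC dR) (map_derivationC dRR).
    by rewrite !derivC !polyC0.
  (* Dividing by [a + b] moves [(a, b, 0)] to a point of the edge, at the cost of the factor
     [(a + b)^p]. *)
  apply: poly2_eq0 => a b a0 b0; have := evP a b 0; rewrite !polyC0 => ->.
  have w0 : a + b != 0 by rewrite gt_eqF ?addr_gt0.
  have -> : a = (a + b) * (a / (a + b)) by field.
  have eb : b = (a + b) * (1 - a / (a + b)) by field.
  have -> : reflsum c p d ((a + b) * (a / (a + b))) b 0 =
      (a + b) ^+ p * reflsum c p d (a / (a + b)) (1 - a / (a + b)) 0.
    by rewrite -reflsum_scale // -eb mulr0.
  have t01 : 0 <= a / (a + b) <= 1.
    by rewrite divr_ge0 ?(ltW (addr_gt0 a0 b0)) ?(ltW a0) // ler_pdivrMr ?addr_gt0 // mul1r lerDl ltW.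
  have := edge0 _ t01; rewrite sum_brefl subrr => /eqP.
  by rewrite mulf_eq0 invr_eq0 pnatr_eq0 orbF => /eqP ->; rewrite mulr0.
apply: (reflsum_indep hd) => a b b' _.
by rewrite -evP P0 !horner0.
Qed.

(** * Affine coordinates on the facets *)

Section Geometry.
Variable R : realType.
Implicit Types (V W U : 'rV[R]_3) (s t : R).

Lemma chi_barycentric V W U s t :
  chi V W U s t = (1 - s - t) *: V + s *: W + t *: U.
Proof. by rewrite /chi !scalerBr !scalerBl scale1r; apply/rowP => i; rewrite !mxE; ring. Qed.

Lemma chi_rot V W U s t : chi V W U s t = chi W U V t (1 - s - t).
Proof. by rewrite !chi_barycentric; apply/rowP => i; rewrite !mxE; ring. Qed.

Lemma chi_swap V W U s t : chi V W U s t = chi V U W t s.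
Proof. by rewrite !chi_barycentric; apply/rowP => i; rewrite !mxE; ring. Qed.

Lemma in_tri_rot s t : in_tri s t -> in_tri t (1 - s - t).
Proof.
case=> s0 [t0 st]; split=> //; split; first by rewrite -addrA -opprD subr_ge0.
by rewrite addrCA subrr addr0 lerBlDr lerDl.
Qed.

Lemma in_tri_swap s t : in_tri s t -> in_tri t s.
Proof. by case=> s0 [t0 st]; split=> //; split=> //; rewrite addrC. Qed.

(** Eliminating [a ord0] leaves a relation between the edge vectors at [A ord0], the rows of an
    invertible matrix. *)
Lemma tetrahedron_affine_indep (A : 'I_4 -> 'rV[R]_3) (a : 'I_4 -> R) :
  tetrahedron A -> \sum_m a m = 0 -> \sum_m a m *: A m = 0 -> forall m, a m = 0.
Proof.
move=> tA suma sumaA.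
have a0E : a ord0 = - \sum_(i < 3) a (lift ord0 i).
  by apply/eqP; rewrite -addr_eq0 -[X in X + _]/(a ord0) -big_ord_recl suma.
pose M := \matrix_(i < 3) (A (lift ord0 i) - A ord0).
pose v : 'rV[R]_3 := \row_i a (lift ord0 i).
have vM : v *m M = 0.
  rewrite mulmx_sum_row -[RHS]sumaA [RHS]big_ord_recl a0E scaleNr scaler_suml -sumrN -big_split.
  by apply: eq_bigr => i _; rewrite rowK mxE scalerBr addrC.
have v0 : v = 0.
  by rewrite -[v]mulmx1 -(mulmxV (_ : M \in unitmx)) ?unitmxE ?unitfE // mulmxA vM mul0mx.
have aS i : a (lift ord0 i) = 0 by move/rowP: v0 => /(_ i); rewrite !mxE.
move=> m; case: (unliftP ord0 m) => [i|] ->; first exact: aS.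
by rewrite a0E big1 ?oppr0.
Qed.

Lemma chi_inj (A : 'I_4 -> 'rV[R]_3) (i j l : 'I_4) s t s' t' :
  tetrahedron A -> [/\ i != j, j != l & i != l] ->
  chi (A i) (A j) (A l) s t = chi (A i) (A j) (A l) s' t' -> s = s' /\ t = t'.
Proof.
move=> tA [ij jl il] e.
(* The differences of the barycentric coordinates, extended by 0 to the fourth vertex. *)
pose a (m : 'I_4) := (m == i)%:R * (s' + t' - s - t) + (m == j)%:R * (s - s') + (m == l)%:R * (t - t').
have suml (V : lmodType R) (B : 'I_4 -> V) :
    \sum_m a m *: B m = (s' + t' - s - t) *: B i + (s - s') *: B j + (t - t') *: B l.
  rewrite (eq_bigr (fun m => (m == i)%:R *: ((s' + t' - s - t) *: B m)
     + (m == j)%:R *: ((s - s') *: B m) + (m == l)%:R *: ((t - t') *: B m))); last first.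
    by move=> m _; rewrite /a 2!scalerDl !scalerA.
  have pick (k : 'I_4) (F : 'I_4 -> V) : \sum_m (m == k)%:R *: F m = F k.
    rewrite (bigD1 k) //= eqxx scale1r big1 ?addr0 // => m /negPf->.
    by rewrite scale0r.
  by rewrite !big_split /= !pick.
have a0 : forall m, a m = 0.
  apply: (tetrahedron_affine_indep tA).
    have := suml R^o (fun=> 1); rewrite (eq_bigr a) => [->|m _]; last by rewrite /GRing.scale /= mulr1.
    by rewrite /GRing.scale /=; ring.
  rewrite suml; move: e; rewrite !chi_barycentric => /eqP; rewrite -subr_eq0 => /eqP <-.
  by apply/rowP => m; rewrite !mxE; ring.
have := a0 j; have := a0 l; rewrite /a !eqxx (negPf jl) [l == i]eq_sym (negPf il) [j == i]eq_sym.
rewrite (negPf ij) [l == j]eq_sym (negPf jl) !mul0r !mul1r !add0r addr0.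
by move=> /eqP; rewrite subr_eq0 => /eqP -> /eqP; rewrite subr_eq0 => /eqP ->.
Qed.

(** The pair [(s, t)] itself shows that [epsilon] has a solution to choose; injectivity makes it the
    only one. *)
Lemma chi_invK (A : 'I_4 -> 'rV[R]_3) (i j l : 'I_4) s t :
  tetrahedron A -> [/\ i != j, j != l & i != l] -> in_tri s t ->
  chi_inv (A i) (A j) (A l) (chi (A i) (A j) (A l) s t) = (s, t).
Proof.
move=> tA ijl st; rewrite /chi_inv.
set P := fun _ : R * R => _.
have /(epsilon_spec (inhabits (0 : R, 0 : R))) : exists q, P q by exists (s, t).
rewrite -/P; case: (epsilon _ _) => a b [/= _ /(chi_inj tA ijl)].
by case=> -> ->.
Qed.

End Geometry.

(** * Symmetries of [brefl] *)

(** Legendre polynomials of even degree are even: reversing the sum exchanges [i] and [2 k - i],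
    which have the same parity. *)
Lemma legform_double_swap (A : comNzRingType) k (x y : A) :
  legform (2 * k) x y = legform (2 * k) y x.
Proof.
rewrite /legform (reindex_inj rev_ord_inj) /=; apply: eq_bigr => -[i /= hi] _.
rewrite subSS bin_sub // subKn // [(- y) ^+ _]exprNn [(- x) ^+ _]exprNn.
rewrite -[in (-1) ^+ (2 * k - i)]signr_odd oddB // oddM /= signr_odd.
by rewrite mulrAC mulrA.
Qed.

Section Reflection.
Variable R : realType.

(** The swap fixes [b_{p,2k}] and exchanges its two rotated copies. *)
Lemma brefl_swap p k (s t : R) : brefl p k s t = brefl p k t s.
Proof.
have bpk_swap (a b : R) : bpk p (2 * k) a b = bpk p (2 * k) b a.
  rewrite !bpk_jacform; have -> : 1 - b - a = 1 - a - b :> R by ring.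
  by rewrite /jacform [b + a]addrC legform_double_swap.
rewrite /brefl /Pi [1 - t - s]addrAC (bpk_swap s t) (bpk_swap t (1 - s - t)).
by rewrite (bpk_swap (1 - s - t) s) [X in X / _ = _]addrAC.
Qed.

(** [Pi] subtracts from a function its mean over the three rotations of the triangle. *)
Lemma brefl_rot_sum p k (s t : R) :
  brefl p k s t + brefl p k t (1 - s - t) + brefl p k (1 - s - t) s = 0.
Proof.
rewrite /brefl /Pi.
have -> : 1 - t - (1 - s - t) = s by ring.
have -> : 1 - (1 - s - t) - s = t by ring.
by field.
Qed.
End Reflection.

(** * Independence of the functions [Q] on the boundary *)

Lemma ltn_d_refl p k : (k < d_refl p)%N = (3 * k + 1 <= p)%N.
Proof. by rewrite /d_refl; lia. Qed.

Lemma brefl_sum_rot (R : realType) (c : nat -> R) (p d : nat) (s t : R) :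
  \sum_(k < d) c k * brefl p k s t + \sum_(k < d) c k * brefl p k t (1 - s - t)
    + \sum_(k < d) c k * brefl p k (1 - s - t) s = 0.
Proof.
rewrite -!big_split big1 //= => k _.
by rewrite -!mulrDr brefl_rot_sum mulr0.
Qed.

(** The facet opposite to [A i] isolates the index [i]: there the functions of index [i] are
    rotation invariant, while the others are [brefl] seen from its three vertices and cancel over
    the rotations. *)
Lemma Q_indep (R : realType) (p : nat) (A : 'I_4 -> 'rV[R]_3)
    (Q : 'I_4 -> nat -> 'rV[R]_3 -> R) (c : 'I_4 -> nat -> R) :
  is_Q p A Q ->
  (forall x, boundary A x -> \sum_(i < 4) \sum_(k < d_refl p) c i k * Q i k x = 0) ->
  forall (i : 'I_4) (k : nat), (k < d_refl p)%N -> c i k = 0.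
Proof.
move=> QP sum0 i.
pose f (n : 'I_3) := lift i n.
pose j := f ord0; pose l := f (lift ord0 ord0); pose m := f ord_max.
have ne (n n' : 'I_3) : n != n' -> f n != f n' by rewrite (inj_eq (@lift_inj _ i)).
have ij : i != j by apply: neq_lift.
have il : i != l by apply: neq_lift.
have im : i != m by apply: neq_lift.
have jl : j != l by apply: ne.
have jm : j != m by apply: ne.
have lm : l != m by apply: ne.
have sum4 (F : 'I_4 -> R) : \sum_n F n = F i + F j + F l + F m.
  rewrite (bigD1 i) //= (bigD1 j) 1?eq_sym //= (bigD1 l) /=; last by rewrite eq_sym il eq_sym.
  rewrite (bigD1 m) /=; last by rewrite ![m == _]eq_sym im jm lm.
  rewrite big1 ?addr0 ?addrA // => n; case: (unliftP i n) => [n'|] ->; last by rewrite eqxx.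
  rewrite /j /l /m /f !(inj_eq (@lift_inj _ i)).
  have : [|| n' == ord0, n' == lift ord0 ord0 | n' == ord_max] by case: n' => [[|[|[|]]]].
  by case/or3P => ->; rewrite ?andbF.
(* [S] is the part of index [i] on the opposite facet; [B n] is that of a vertex [n] of this facet,
   in coordinates based at [n]. *)
pose S s t := \sum_(k < d_refl p) c i k * Q i k (chi (A j) (A l) (A m) s t).
pose B n s t := \sum_(k < d_refl p) c n k * brefl p k s t.
have facet s t : in_tri s t -> S s t + B j s t + B l t (1 - s - t) + B m (1 - s - t) s = 0.
  move=> st; have st1 := in_tri_rot st; have st2 := in_tri_rot st1.
  have us : 1 - t - (1 - s - t) = s by ring.
  have := sum0 (chi (A j) (A l) (A m) s t); rewrite sum4 => sum0'; rewrite -[RHS]sum0'; last first.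
    by exists j, l, m; split=> //; exists s, t.
  congr (_ + _ + _ + _); apply: eq_bigr => -[k /= hk] _; congr (_ * _).
  - by have [-> //] := QP j k hk; split.
  - rewrite chi_rot; have [-> //] := QP l k hk; split=> //; by rewrite eq_sym.
  - rewrite 2!chi_rot us; have [-> //] := QP m k hk; last by rewrite us in st2.
    by split; rewrite // eq_sym.
have S_rot s t : in_tri s t -> S t (1 - s - t) = S s t.
  move=> st; apply: eq_bigr => -[k /= hk] _; congr (_ * _).
  have [_ [q [_ [qs [_ Qq]]]]] := QP i k hk.
  have hjlm : [/\ i != j, i != l, i != m & [/\ j != l, j != m & l != m]] by [].
  rewrite !(Qq _ _ _ hjlm) //; last exact: in_tri_rot.
  by have [_ _ -> _ _] := qs s t.
have S0 s t : in_tri s t -> S s t = 0.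
  move=> st; have st1 := in_tri_rot st; have st2 := in_tri_rot st1.
  have us : 1 - t - (1 - s - t) = s by ring.
  have ut : 1 - (1 - s - t) - s = t by ring.
  have e1 := facet _ _ st; have e2 := facet _ _ st1; have e3 := facet _ _ st2.
  have S1 := S_rot _ _ st; have S2 := S_rot _ _ st1.
  rewrite us ?ut in e2 e3 S2.
  have bj := brefl_sum_rot (c j) p (d_refl p) s t.
  have bl := brefl_sum_rot (c l) p (d_refl p) s t.
  have bm := brefl_sum_rot (c m) p (d_refl p) s t.
  rewrite -!/(B _ _ _) in bj bl bm.
  (* Adding the relation at the three rotated points cancels all [B] terms. *)
  have : 3 * S s t = 0.
    rewrite S2 S1 in e3; rewrite S1 in e2.
    transitivity ((S s t + B j s t + B l t (1 - s - t) + B m (1 - s - t) s)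
      + (S s t + B j t (1 - s - t) + B l (1 - s - t) s + B m s t)
      + (S s t + B j (1 - s - t) s + B l s t + B m t (1 - s - t))
      - (B j s t + B j t (1 - s - t) + B j (1 - s - t) s)
      - (B l s t + B l t (1 - s - t) + B l (1 - s - t) s)
      - (B m s t + B m t (1 - s - t) + B m (1 - s - t) s)); first by ring.
    by rewrite e1 e2 e3 bj bl bm; ring.
  by move/eqP; rewrite mulf_eq0 pnatr_eq0 => /eqP.
apply: (@edge_indep R (c i) p (d_refl p)) => [k|t t01]; first by rewrite ltn_d_refl.
have /andP[t0 t1] := t01.
have tt : in_tri t (1 - t) by split=> //; rewrite subr_ge0 addrC subrK.
transitivity (S t (1 - t)); last exact: S0.
apply: eq_bigr => -[k /= hk] _; congr (_ * _).
have [_ [q [_ [_ [qe Qq]]]]] := QP i k hk.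
by rewrite (Qq j l m) //; have [-> _ _] := qe _ t01.
Qed.

(** * The span of the generators on a facet *)

(** The symmetry of [brefl] in its arguments absorbs the orientation bit. *)
Lemma brefl_pull_chi (R : realType) (p k : nat) (A : 'I_4 -> 'rV[R]_3) (i j l : 'I_4)
    (b : bool) (s t : R) :
  tetrahedron A -> [/\ i != j, j != l & i != l] -> in_tri s t ->
  brefl_pull p k (A i) (orient b (A j) (A l)).1 (orient b (A j) (A l)).2
    (chi (A i) (A j) (A l) s t) = brefl p k s t.
Proof.
move=> tA [ij jl il] st; rewrite /brefl_pull; case: b => /=.
  by rewrite chi_invK.
rewrite chi_swap chi_invK //=; [exact: brefl_swap| |exact: in_tri_swap].
by split; rewrite // eq_sym.
Qed.

(** Changing the base vertex rotates the arguments of [brefl]. The list has three blocks of length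
    [d], one per vertex, hence the shifted indices. *)
Lemma sum_refl_gens (R : realType) (p : nat) (A : 'I_4 -> 'rV[R]_3) (i j l : 'I_4)
    (b0 b1 b2 : bool) (c : nat -> R) (s t : R) :
  tetrahedron A -> [/\ i != j, j != l & i != l] -> in_tri s t ->
  let gs := refl_gens p (A i) (A j) (A l) b0 b1 b2 in
  let d := d_refl p in
  \sum_(n < size gs) c n * nth (fun _ => 0) gs n (chi (A i) (A j) (A l) s t) =
  \sum_(k < d) c k * brefl p k s t + \sum_(k < d) c (d + k)%N * brefl p k t (1 - s - t)
    + \sum_(k < d) c (d + (d + k))%N * brefl p k (1 - s - t) s.
Proof.
move=> tA ijl st gs d; have [ij jl il] := ijl.
have st1 := in_tri_rot st; have st2 := in_tri_rot st1.
have us : 1 - t - (1 - s - t) = s by ring.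
set x := chi _ _ _ _ _.
have sum_iota (g : nat -> 'rV[R]_3 -> R) (c' : nat -> R) :
    \sum_(n < size [seq g m | m <- iota 0 d]) c' n * nth (fun _ => 0) [seq g m | m <- iota 0 d] n x
    = \sum_(k < d) c' k * g k x.
  rewrite size_map size_iota; apply: eq_bigr => k _.
  by rewrite (nth_map 0) ?size_iota // nth_iota.
have cat_nth (c' : nat -> R) (s1 s2 : seq ('rV[R]_3 -> R)) :
  \sum_(n < size (s1 ++ s2)) c' n * nth (fun _ => 0) (s1 ++ s2) n x =
  \sum_(n < size s1) c' n * nth (fun _ => 0) s1 n x
  + \sum_(n < size s2) c' (size s1 + n)%N * nth (fun _ => 0) s2 n x.
  rewrite size_cat big_split_ord /=; congr (_ + _); apply: eq_bigr => n _; rewrite nth_cat.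
    by rewrite ltn_ord.
  by rewrite ltnNge leq_addr /= addKn.
rewrite /gs /refl_gens cat_nth (cat_nth (fun n => c (_ + n)%N)) !sum_iota.
rewrite (sum_iota _ (fun n => c (_ + n)%N)) (sum_iota _ (fun n => c (_ + (_ + n))%N)).
rewrite !size_map size_iota addrA; congr (_ + _ + _); apply: eq_bigr => k _; congr (_ * _).
- exact: brefl_pull_chi.
- by rewrite /x chi_rot brefl_pull_chi //; split; rewrite // eq_sym.
- rewrite /x 2!chi_rot us brefl_pull_chi //; last by rewrite us in st2.
  by split; rewrite // eq_sym.
Qed.

Lemma Pperp_ref_sum (R : realType) (p : nat) (c1 c2 : nat -> R) (s t : R) :
  \sum_(k < p.+1 | (3 * k + 1 <= p)%N)
     (c1 k * brefl p k (1 - s - t) s + c2 k * brefl p k t (1 - s - t)) =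
  \sum_(k < d_refl p) (c1 k * brefl p k (1 - s - t) s + c2 k * brefl p k t (1 - s - t)).
Proof.
pose F k := c1 k * brefl p k (1 - s - t) s + c2 k * brefl p k t (1 - s - t).
rewrite (big_ord_widen p.+1 F); last by rewrite /d_refl; lia.
by apply: eq_bigl => k; rewrite ltn_d_refl.
Qed.

(** By [brefl_rot_sum] each generator at [A i] is minus the sum of those at the other two vertices,
    and these span the target space. *)
Lemma span_refl_gens (R : realType) (p : nat) (A : 'I_4 -> 'rV[R]_3) (i j l : 'I_4)
    (b0 b1 b2 : bool) (h : 'rV[R]_3 -> R) :
  tetrahedron A -> [/\ i != j, j != l & i != l] ->
  span_on (on_tri (A i) (A j) (A l)) (refl_gens p (A i) (A j) (A l) b0 b1 b2) h
  <-> PperpT p (A i) (A j) (A l) h.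
Proof.
move=> tA ijl; set d := d_refl p; split.
  case=> c hc.
  exists (fun s t => \sum_(k < p.+1 | (3 * k + 1 <= p)%N)
    ((c (d + (d + k))%N - c k) * brefl p k (1 - s - t) s
      + (c (d + k)%N - c k) * brefl p k t (1 - s - t))); split.
    by exists (fun k => c (d + (d + k))%N - c k), (fun k => c (d + k)%N - c k).
  move=> x xT; rewrite (hc x xT); case: xT => s [t [st ->]].
  rewrite chi_invK //= sum_refl_gens //.
  rewrite (Pperp_ref_sum _ (fun k => c (d + (d + k))%N - c k) (fun k => c (d + k)%N - c k)).
  rewrite -!big_split; apply: eq_bigr => k _ /=.
  have -> : brefl p k s t = - (brefl p k t (1 - s - t) + brefl p k (1 - s - t) s).
    by apply/eqP; rewrite -addr_eq0 addrA brefl_rot_sum.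
  by ring.
case=> u [[c1 [c2 uE]] hu].
(* Zero on the block of [A i]; the blocks of [A j] and [A l] carry [c2] and [c1], in this order. *)
pose c n := if (n < d)%N then 0 else if (n < d + d)%N then c2 (n - d)%N else c1 (n - d - d)%N.
exists c; move=> x xT; rewrite (hu x xT); case: xT => s [t [st ->]].
rewrite sum_refl_gens // chi_invK //= uE Pperp_ref_sum -!big_split; apply: eq_bigr => k _ /=.
rewrite /c ltn_ord -/d !ltnNge !leq_addr /= leq_add2l -ltnNge ltn_ord leq_add2l leq_addr /=.
by rewrite addKn addnA -subnDA addKn; ring.
Qed.

Theorem theorem31 (R : realType) (p : nat) (A : 'I_4 -> 'rV[R]_3) :
  tetrahedron A ->
  (* (a) linear independence of the Q^{(i)}_k on the boundary of K *)
  (forall Q : 'I_4 -> nat -> 'rV[R]_3 -> R, is_Q p A Q ->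
     forall c : 'I_4 -> nat -> R,
       (forall x, boundary A x ->
          \sum_(i < 4) \sum_(k < d_refl p) c i k * Q i k x = 0) ->
       forall (i : 'I_4) (k : nat), (k < d_refl p)%N -> c i k = 0)
  /\
  (* (b) for every facet T = A_i A_j A_l, every vertex P = A_i, and any choice
     of the affine maps chi_{V,T} *)
  (forall (i j l : 'I_4), [/\ i != j, j != l & i != l] ->
     forall b0 b1 b2 : bool, forall h : 'rV[R]_3 -> R,
       span_on (on_tri (A i) (A j) (A l)) (refl_gens p (A i) (A j) (A l) b0 b1 b2) h
       <-> PperpT p (A i) (A j) (A l) h).
Proof.
move=> tA; split=> [Q QP c sum0|i j l ijl b0 b1 b2 h]; first exact: (Q_indep QP sum0).
exact: span_refl_gens.
Qed.
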